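(* Let $\Sigma=(A,B,C,D)$ be a minimal state space system with $A\in\mathbb{R}^{n\times n}$, $B\in\mathbb{R}^{n\times m}$, $C\in\mathbb{R}^{m\times n}$, $D\in\mathbb{R}^{m\times m}$. Then $\Sigma$ is input-output Hamiltonian (with respect to $\sigma=I_m$) if and only if the input-output behavior of compact support of $(A,B,C,D)$ is the same as the input-output behavior of compact support of its adjoint system $(-A^\top,-C^\top,B^\top,D^\top)$.
   Context: The system $(A,B,C,D)$ is $\dot x=Ax+Bu$, $y=Cx+Du$, with transfer matrix $K(s)=C(sI-A)^{-1}B+D$; minimal means controllable and observable. It is input-output (IO) Hamiltonian with respect to a signature matrix $\sigma$ (diagonal with entries $\pm1$) if $\sigma K(s)=K^\top(-s)\sigma$; here $\sigma=I_m$, so the condition is $K(s)=K^\top(-s)$. The adjoint system $(-A^\top,-C^\top,B^\top,D^\top)$ is $\dot p=-A^\top p-C^\top u^a$, $y^a=B^\top p+D^\top u^a$, with input $u^a$ and output $y^a$ in $\mathbb{R}^m$. The input-output behavior of compact support of a system is the set of all pairs $(u,y)$ of signals $u,y\in L_2(\mathbb{R},\mathbb{R}^m)$, both of compact support, for which there exists a state trajectory on $(-\infty,\infty)$ such that the system equations hold. *)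

(* Defs.v *)
From HB Require Import structures.
From mathcomp Require Import all_boot all_order all_algebra.
From mathcomp Require Import all_classical all_reals all_analysis.

Set Implicit Arguments.
Unset Strict Implicit.
Unset Printing Implicit Defensive.

Import Order.TTheory GRing.Theory Num.Theory.
Import numFieldNormedType.Exports.

Local Open Scope classical_set_scope.
Local Open Scope ring_scope.

Record system (R : realType) (n m : nat) := System {
  sysA : 'M[R]_n;
  sysB : 'M[R]_(n, m);
  sysC : 'M[R]_(m, n);
  sysD : 'M[R]_m }.

Section TransferMatrix.
Variables (R : realType) (n m : nat).

(* The field of rational functions R(s), and the embedding of constants. *)
Definition ratfun : fieldType := {fraction {poly R}}.

Definition ratconst (a : R) : ratfun := tofrac a%:P.

Definition ratvar : ratfun := tofrac 'X.

(* C (sI - A)^-1 B + D, as a matrix over R(s), at a point [s] of R(s).  The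
   matrix sI - A is invertible whenever [s] is not a constant, so that at
   [ratvar] this is K(s), and at [- ratvar] it is K(-s). *)
Definition transfer (S : system R n m) (s : ratfun) : 'M[ratfun]_m :=
  map_mx ratconst (sysC S) *m invmx (s%:M - map_mx ratconst (sysA S))
    *m map_mx ratconst (sysB S) + map_mx ratconst (sysD S).

(* [sigma] is meant to be a signature matrix. *)
Definition io_hamiltonian (sigma : 'M[R]_m) (S : system R n m) : Prop :=
  map_mx ratconst sigma *m transfer S ratvar =
  (transfer S (- ratvar))^T *m map_mx ratconst sigma.

End TransferMatrix.

Section Behavior.
Variables (R : realType) (n m : nat).

Local Notation mu := (@lebesgue_measure R).

(* Signals are represented by functions; all conditions on inputs and outputs
   below are invariant under modification on null sets. *)
Definition L2_signal k (w : R -> 'cV[R]_k) : Prop :=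
  forall i, (fun t => w t i 0) \in Lfun mu 2%:E.

Definition compact_support k (w : R -> 'cV[R]_k) : Prop :=
  exists T : R, {ae mu, forall t, T < `|t| -> w t = 0}.

Definition vintegral k (a b : R) (f : R -> 'cV[R]_k) : 'cV[R]_k :=
  \col_i (\int[mu]_(t in `[a, b]) f t i 0)%R.

(* x' = A x + B u on the whole line in the sense of Caratheodory, in integral
   form.  For continuous [x] and [u] in L2 the integrand is integrable on
   bounded intervals. *)
Definition state_trajectory (S : system R n m)
    (u : R -> 'cV[R]_m) (x : R -> 'cV[R]_n) : Prop :=
  continuous x /\
  forall a b, a <= b ->
    x b = x a + vintegral a b (fun t => sysA S *m x t + sysB S *m u t).

Definition output (S : system R n m)
    (u : R -> 'cV[R]_m) (x : R -> 'cV[R]_n) (t : R) : 'cV[R]_m :=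
  sysC S *m x t + sysD S *m u t.

Definition controllable (S : system R n m) : Prop :=
  forall x0 x1 : 'cV[R]_n, exists (T : R) u x,
    [/\ 0 < T, L2_signal u, state_trajectory S u x, x 0 = x0 & x T = x1].

Definition observable (S : system R n m) : Prop :=
  forall u x x', L2_signal u ->
    state_trajectory S u x -> state_trajectory S u x' ->
    (forall t, 0 <= t -> output S u x t = output S u x' t) ->
    x 0 = x' 0.

Definition minimal (S : system R n m) : Prop :=
  controllable S /\ observable S.

Definition compact_behavior (S : system R n m) :
    set ((R -> 'cV[R]_m) * (R -> 'cV[R]_m)) :=
  [set uy | [/\ L2_signal uy.1, L2_signal uy.2,
      compact_support uy.1, compact_support uy.2 &
      exists2 x, state_trajectory S uy.1 x &
        {ae mu, forall t, uy.2 t = output S uy.1 x t}]].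

End Behavior.

(* Main.v *)
(* Write S for the system and Sa for its adjoint.  Since the transfer matrix of
   Sa is K(-s)^T, the IO Hamiltonian property says that S and Sa have the same
   transfer matrix, and this amounts to equality of all Markov parameters
   D, C A^k B.

   If the Markov parameters agree, minimality gives an invertible Q with
   Q A = - A^T Q, Q B = - C^T and B^T Q = C, so that x |-> Q x carries the
   trajectories of S to those of Sa and the behaviors coincide.

   Conversely let chi be the characteristic polynomial of A and
   phi(t) = t^n (t - 1)^n.  The input u = chi(d/dt) phi v on [0, 1], extended by 0,
   steers the state x = adj(d/dt - A) B phi v of S from 0 to 0, so (u, y) lies
   in both behaviors; let p be a state of Sa producing it.  Observability of Sa
   gives p(0) = 0, whereas u(0+) is a nonzero multiple of v.  Hence letting
   t -> 0+ in C x + D u = B^T p + D^T u yields D v = D^T v, and after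
   cancelling and differentiating k + 1 times, equality of the k-th Markov
   parameters. *)

Require Import Defs.
From HB Require Import structures.
From mathcomp Require Import all_boot all_order all_algebra.
From mathcomp Require Import all_classical all_reals all_analysis.
From mathcomp Require Import measurable_realfun ring.

Set Implicit Arguments.
Unset Strict Implicit.
Unset Printing Implicit Defensive.

Import Order.TTheory GRing.Theory Num.Theory.
Import numFieldNormedType.Exports.

Local Open Scope classical_set_scope.
Local Open Scope ring_scope.

(** * State space isomorphism *)

Lemma char_poly_power_eq0 (R : comNzRingType) (n : nat) (A : 'M[R]_n) :
  \sum_(i < n.+1) (char_poly A)`_i *: A ^+ i = 0.
Proof.
case: n A => [|n] A; first by apply/matrixP => -[].
apply: etrans (Cayley_Hamilton A); rewrite -[X in horner_mx A X]coefK size_char_poly poly_def.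
rewrite rmorph_sum; apply: eq_bigr => i _ /=.
by rewrite horner_mxZ rmorphXn /= horner_mx_X.
Qed.

Lemma char_poly_lead (R : comNzRingType) (n : nat) (A : 'M[R]_n) :
  (char_poly A)`_n = 1.
Proof.
by have := char_poly_monic A; rewrite monicE lead_coefE size_char_poly => /eqP.
Qed.

(** By Cayley-Hamilton, [A ^+ k] with [k >= n] is a combination of the n powers preceding it, so
    strong induction extends the vanishing to all k. This lets a finite Gram matrix detect
    controllability. *)
Lemma expmx_row_annihilator (R : comNzRingType) (n m : nat) (A : 'M[R]_n)
    (B : 'M[R]_(n, m)) (w : 'rV_n) :
  (forall k, (k < n)%N -> w *m A ^+ k *m B = 0) ->
  forall k, w *m A ^+ k *m B = 0.
Proof.
move=> wAB k; elim/ltn_ind: k => k IHk.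
have [/wAB//|le_nk] := ltnP k n.
have := char_poly_power_eq0 A; rewrite big_ord_recr /= char_poly_lead scale1r.
move/eqP; rewrite addrC addr_eq0 => /eqP An.
rewrite -(subnK le_nk) addnC exprD An -mulmxE mulNmx mulmxN mulNmx.
rewrite mulmx_suml mulmx_sumr mulmx_suml big1 ?oppr0 // => i _.
rewrite -!scalemxAl -scalemxAr -scalemxAl mulmxE -exprD IHk ?scaler0 //.
by rewrite -[ltnRHS](subnKC le_nk) ltn_add2r.
Qed.

(* Q = (sum_k R2_k R1_k^T) W^-1, with R_k = A^k B and W the Gram matrix
   sum_k R1_k R1_k^T of the first system. *)
Lemma state_space_isomorphism (R : realFieldType) (n m : nat)
    (A1 A2 : 'M[R]_n) (B1 B2 : 'M[R]_(n, m)) (C1 C2 : 'M[R]_(m, n)) :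
  (forall w : 'rV_n, (forall k, w *m A1 ^+ k *m B1 = 0) -> w = 0) ->
  (forall v : 'cV_n, (forall k, C1 *m A1 ^+ k *m v = 0) -> v = 0) ->
  (forall v : 'cV_n, (forall k, C2 *m A2 ^+ k *m v = 0) -> v = 0) ->
  (forall k, C1 *m A1 ^+ k *m B1 = C2 *m A2 ^+ k *m B2) ->
  exists Q, [/\ Q \in unitmx, Q *m A1 = A2 *m Q, Q *m B1 = B2 & C2 *m Q = C1].
Proof.
move=> ctrl1 obs1 obs2 markov.
have obs2_inj q (M N : 'M[R]_(n, q)) :
    (forall k, C2 *m A2 ^+ k *m M = C2 *m A2 ^+ k *m N) -> M = N.
  move=> eqMN; apply/subr0_eq/matrixP => i j; rewrite [RHS]mxE.
  suff /colP/(_ i) : col j (M - N) = 0 by rewrite !mxE.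
  by apply: obs2 => k; rewrite colE mulmxA mulmxBr eqMN subrr mul0mx.
pose W := \sum_(k < n) (A1 ^+ k *m B1) *m (A1 ^+ k *m B1)^T.
(* If [w *m W = 0], then w W w^T is the sum over k < n of the squared norms of w A1^k B1, so each of
   these rows is 0. *)
have Wu : W \in unitmx.
  rewrite -row_free_unit; apply: inj_row_free => w wW.
  apply: ctrl1; apply: expmx_row_annihilator => k ltkn.
  have : w *m W *m w^T = 0 by rewrite wW mul0mx.
  rewrite /W mulmx_sumr mulmx_suml.
  pose g (i : 'I_n) := w *m A1 ^+ i *m B1.
  rewrite (eq_bigr (fun i => g i *m (g i)^T)); last first.
    by move=> i _; rewrite /g -[w *m _ *m B1]mulmxA [(w *m _)^T]trmx_mul !mulmxA.
  have g2 (i : 'I_n) : (g i *m (g i)^T) 0 0 = \sum_j g i 0 j ^+ 2.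
    by rewrite mxE; apply: eq_bigr => j _; rewrite [X in _ * X]mxE expr2.
  move/matrixP => /(_ 0 0); rewrite summxE mxE => /eqP.
  rewrite psumr_eq0; last by move=> i _; rewrite g2 sumr_ge0 // => j _; exact: sqr_ge0.
  move=> /allP/(_ (Ordinal ltkn)); rewrite mem_index_enum g2 => /(_ isT) /=.
  rewrite psumr_eq0; last by move=> j _; exact: sqr_ge0.
  move=> /allP gk; apply/rowP => j; rewrite [RHS]mxE.
  by have := gk j; rewrite mem_index_enum sqrf_eq0 => /(_ isT) /eqP.
pose Q := (\sum_(k < n) (A2 ^+ k *m B2) *m (A1 ^+ k *m B1)^T) *m invmx W.
(* Multiplying C2 A2^i into the sum defining [Q] produces Markov parameters of index i + k;
   replacing them by those of the first system turns the sum into C1 A1^i W. *)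
have OQ i : C2 *m A2 ^+ i *m Q = C1 *m A1 ^+ i.
  rewrite -[RHS](mulmxK Wu) /Q mulmxA; congr (_ *m _).
  rewrite !mulmx_sumr; apply: eq_bigr => k _; rewrite !mulmxA; congr (_ *m _).
  have := markov (i + k)%N; rewrite !exprD -!mulmxE !mulmxA => <-.
  by [].
have QC : C2 *m Q = C1 by have := OQ 0; rewrite !expr0 !mulmx1.
exists Q; split=> //.
(* A kernel vector v of [Q] has C1 A1^k v = C2 A2^k Q v = 0 for all k, so observability of the first
   system kills it. *)
- rewrite -unitmx_tr -row_free_unit; apply: inj_row_free => v.
  move=> /(congr1 trmx); rewrite trmx_mul trmxK trmx0 => Qv.
  rewrite -[v]trmxK [v^T]obs1 ?trmx0 // => k.
  by rewrite -OQ -mulmxA Qv mulmx0.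
- apply: obs2_inj => i; rewrite [LHS]mulmxA OQ.
  by have := OQ i.+1; rewrite !exprSr -!mulmxE !mulmxA => <-.
- by apply: obs2_inj => i; rewrite [LHS]mulmxA OQ markov.
Qed.

(** * Transfer matrices and Markov parameters *)

HB.instance Definition _ (R : realType) :=
  GRing.RMorphism.copy (@ratconst R) (@tofrac {poly R} \o polyC).

Lemma map_ratconst (R : realType) (p q : nat) (M : 'M[R]_(p, q)) :
  map_mx (@ratconst R) M = map_mx (@tofrac {poly R}) (map_mx polyC M).
Proof. exact: map_mx_comp. Qed.

(* Locked, because unification up to conversion through [invmx] over R(s)
   practically diverges. *)
Definition resolvent (R : realType) (n : nat) (A : 'M[R]_n) :
    'M[ratfun R]_n :=
  locked (invmx ((ratvar R)%:M - map_mx (@ratconst R) A)).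

Lemma resolvent_def (R : realType) (n : nat) (A : 'M[R]_n) :
  resolvent A = invmx ((ratvar R)%:M - map_mx (@ratconst R) A).
Proof. by rewrite /resolvent -lock. Qed.

Lemma ratvar_sub_map_mx (R : realType) (n : nat) (A : 'M[R]_n) :
  (ratvar R)%:M - map_mx (@ratconst R) A =
  map_mx (@tofrac {poly R}) (char_poly_mx A).
Proof. by rewrite map_mxB map_scalar_mx -map_ratconst. Qed.

Lemma tofrac_char_poly_neq0 (R : realType) (n : nat) (A : 'M[R]_n) :
  tofrac (char_poly A) != 0.
Proof. by rewrite tofrac_eq0 monic_neq0 // char_poly_monic. Qed.

Lemma ratvar_sub_unitmx (R : realType) (n : nat) (A : 'M[R]_n) :
  (ratvar R)%:M - map_mx (@ratconst R) A \in unitmx.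
Proof.
by rewrite ratvar_sub_map_mx unitmxE det_map_mx unitfE tofrac_char_poly_neq0.
Qed.

Lemma resolventE (R : realType) (n : nat) (A : 'M[R]_n) :
  resolvent A = (tofrac (char_poly A))^-1 *:
                map_mx (@tofrac {poly R}) (\adj (char_poly_mx A)).
Proof.
have U := ratvar_sub_unitmx A.
rewrite resolvent_def /invmx U ratvar_sub_map_mx det_map_mx map_mx_adj.
by [].
Qed.

Lemma mulr_resolvent (R : realType) (n : nat) (A : 'M[R]_n) :
  ratvar R *: resolvent A = 1%:M + map_mx (@ratconst R) A *m resolvent A.
Proof.
rewrite resolvent_def -(mulmxV (ratvar_sub_unitmx A)) -mulmxDl subrK.
by rewrite mul_scalar_mx.
Qed.

(** A cofactor is a signed minor of order n - 1 with entries of degree at most 1. Its degree is thus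
    below n, the degree of [char_poly A], which makes the resolvent strictly proper. *)
Lemma size_adj_char_poly (R : realType) (n : nat) (A : 'M[R]_n) i j :
  (size ((\adj (char_poly_mx A)) i j) <= n)%N.
Proof.
case: n A i j => [|n] A i j; first by case: i.
rewrite mxE /cofactor.
have sgn_size k (p : {poly R}) : size ((-1) ^+ k * p) = size p.
  by rewrite -signr_odd; case: odd; rewrite ?mulN1r ?size_polyN ?mul1r.
rewrite sgn_size; apply: (leq_trans (size_sum _ _ _)); apply/bigmax_leqP => s _.
rewrite sgn_size; apply: leq_trans (size_poly_prod_leq _ _) _.
rewrite card_ord leq_subLR addnS ltnS addnn -muln2.
rewrite -[X in (_ <= X * _)%N]card_ord -sum_nat_const.
apply: leq_sum => k _; rewrite !mxE.
apply: leq_trans (size_polyD _ _) _; rewrite size_polyN geq_max.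
rewrite (leq_trans (size_polyC_leq1 _)) // andbT.
by case: eqP => _; rewrite ?mulr1n ?mulr0n ?size_polyX ?size_poly0.
Qed.

(** This is a = s/q - r/p with denominators cleared. If a were nonzero, the left side would have
    degree deg p + deg q, which the right side cannot reach. *)
Lemma monic_strictly_proper_eq0 (R : idomainType) (p q r s : {poly R}) (a : R) :
  p \is monic -> q \is monic -> (size r < size p)%N -> (size s < size q)%N ->
  a *: (p * q) = p * s - q * r -> a = 0.
Proof.
move=> pm qm ltrp ltsq eqpq; apply/eqP; apply: contraT => a0.
have := congr1 (fun p : {poly R} => size p) eqpq.
rewrite size_scale // size_monicM ?monic_neq0 // => szE.
suff : (size (p * s - q * r)%R < (size p + size q).-1)%N by rewrite -szE ltnn.
rewrite (leq_ltn_trans (size_polyD _ _)) // size_polyN.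
have pred_ltn x y z : (0 < x)%N -> (z < y)%N -> ((x + z).-1 < (x + y).-1)%N.
  by case: x => // x _; rewrite !addSn ltn_add2l.
rewrite gtn_max; apply/andP; split;
  apply: leq_ltn_trans (size_polyMleq _ _) _.
  by apply: pred_ltn; rewrite // size_poly_gt0 monic_neq0.
by rewrite (addnC (size p)); apply: pred_ltn; rewrite // size_poly_gt0 monic_neq0.
Qed.

(** The constant term is the value at infinity, where the resolvent part vanishes. The lemma serves
    to peel off one Laurent coefficient at a time. *)
Lemma resolvent_strictly_proper (R : realType) (n m : nat) (A1 A2 : 'M[R]_n)
    (N1 N2 : 'M[R]_(n, m)) (M1 M2 : 'M[R]_(m, n)) (c1 c2 : 'M[R]_m) :
  let K (c : 'M[R]_m) (M : 'M[R]_(m, n)) A (N : 'M[R]_(n, m)) :=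
    map_mx (@ratconst R) c +
    map_mx (@ratconst R) M *m resolvent A *m map_mx (@ratconst R) N in
  K c1 M1 A1 N1 = K c2 M2 A2 N2 -> c1 = c2.
Proof.
move=> K eqK; apply/matrixP => i j; apply/eqP; rewrite -subr_eq0.
pose P (M : 'M[R]_(m, n)) A (N : 'M[R]_(n, m)) :=
  (map_mx polyC M *m \adj (char_poly_mx A) *m map_mx polyC N) i j.
have sizeP M A N : (size (P M A N) <= n)%N.
  rewrite /P mxE; apply: (leq_trans (size_sum _ _ _)); apply/bigmax_leqP => k _.
  rewrite mxE [X in _ * X]mxE mulrC mul_polyC.
  apply: leq_trans (size_scale_leq _ _) _.
  apply: (leq_trans (size_sum _ _ _)); apply/bigmax_leqP => l _.
  rewrite [X in X * _]mxE mul_polyC.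
  exact: leq_trans (size_scale_leq _ _) (size_adj_char_poly _ _ _).
(* Multiplication by the characteristic polynomial turns each entry into a polynomial, with [P] as
   the numerator of the strictly proper part. *)
have KE c M A N : tofrac (char_poly A) * K c M A N i j =
    tofrac (char_poly A * (c i j)%:P + P M A N).
  rewrite /K mxE [X in _ * (X + _)]mxE mulrDr rmorphD rmorphM; congr (_ + _).
  rewrite resolventE -scalemxAr -scalemxAl mxE mulVKf ?tofrac_char_poly_neq0 //.
  by rewrite /P !map_ratconst -!map_mxM mxE.
have : tofrac (char_poly A2 * (char_poly A1 * (c1 i j)%:P + P M1 A1 N1)) =
       tofrac (char_poly A1 * (char_poly A2 * (c2 i j)%:P + P M2 A2 N2)).
  by rewrite !(rmorphM (@tofrac {poly R})) /= -!KE eqK mulrCA.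
move/eqP; rewrite tofrac_eq -subr_eq0 => /eqP eq0.
apply/eqP; apply: (monic_strictly_proper_eq0 (char_poly_monic A1)
  (char_poly_monic A2) _ _ (r := P M1 A1 N1) (s := P M2 A2 N2)).
- by rewrite size_char_poly ltnS.
- by rewrite size_char_poly ltnS.
move: (char_poly A1) (char_poly A2) (P M1 A1 N1) (P M2 A2 N2) eq0 => p q r t.
move=> eq0; apply/eqP; rewrite -subr_eq0 -eq0; apply/eqP.
by rewrite -mul_polyC rmorphB /=; ring.
Qed.

Lemma transferE (R : realType) (n m : nat) (S : system R n m) :
  transfer S (ratvar R) = map_mx (@ratconst R) (sysD S) +
    map_mx (@ratconst R) (sysC S) *m resolvent (sysA S)
      *m map_mx (@ratconst R) (sysB S).
Proof. by rewrite addrC resolvent_def. Qed.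

(** The Markov parameters are the Laurent coefficients at infinity. With T_k = C A^k (sI - A)^-1 B
    one has s T_k = C A^k B + T_(k+1), so equality of the T_k propagates and its constant terms give
    the claim. *)
Lemma transfer_markov (R : realType) (n m : nat) (S1 S2 : system R n m) :
  transfer S1 (ratvar R) = transfer S2 (ratvar R) ->
  sysD S1 = sysD S2 /\
  (forall k, sysC S1 *m sysA S1 ^+ k *m sysB S1 =
             sysC S2 *m sysA S2 ^+ k *m sysB S2).
Proof.
rewrite !transferE => eqK; have eqD := resolvent_strictly_proper eqK.
split=> // k; move: eqK; rewrite eqD => /addrI eqK.
pose T (S : system R n m) k :=
  map_mx (@ratconst R) (sysC S *m sysA S ^+ k) *m resolvent (sysA S)
    *m map_mx (@ratconst R) (sysB S).
have TS S j : ratvar R *: T S j =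
    map_mx (@ratconst R) (sysC S *m sysA S ^+ j *m sysB S) + T S j.+1.
  rewrite /T scalemxAl scalemxAr mulr_resolvent mulmxDr mulmx1 mulmxDl.
  by rewrite -map_mxM !mulmxA -map_mxM exprSr -mulmxE !mulmxA.
have eqT j : T S1 j = T S2 j.
  elim: j => [|j IHj]; first by rewrite /T !expr0 !mulmx1.
  have := congr1 (fun M => ratvar R *: M) IHj; rewrite /= !TS => eqS.
  by move: (eqS); rewrite (resolvent_strictly_proper eqS) => /addrI.
have := congr1 (fun M => ratvar R *: M) (eqT k); rewrite /= !TS.
exact: resolvent_strictly_proper.
Qed.

Lemma intertwine_invmx (F : fieldType) (n : nat) (M N Q : 'M[F]_n) :
  M \in unitmx -> N \in unitmx -> Q *m M = N *m Q ->
  Q *m invmx M = invmx N *m Q.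
Proof.
move=> uM uN QM; apply: (canRL (mulKmx uN)); rewrite mulmxA.
by apply: (canLR (mulmxK uM)); rewrite QM.
Qed.

Lemma transfer_similar (R : realType) (n m : nat) (S1 S2 : system R n m)
    (Q : 'M[R]_n) :
  Q *m sysA S1 = sysA S2 *m Q -> Q *m sysB S1 = sysB S2 ->
  sysC S2 *m Q = sysC S1 -> sysD S1 = sysD S2 ->
  transfer S1 (ratvar R) = transfer S2 (ratvar R).
Proof.
move=> QA QB QC eqD; rewrite !transferE eqD -QC -QB !map_mxM; congr (_ + _).
have Qres : map_mx (@ratconst R) Q *m resolvent (sysA S1) =
            resolvent (sysA S2) *m map_mx (@ratconst R) Q.
  rewrite !resolvent_def.
  apply: intertwine_invmx; try exact: ratvar_sub_unitmx.
  by rewrite mulmxBl mulmxBr -map_mxM -map_mxM QA -scalar_mxC.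
move: Qres; move: (resolvent (sysA S1)) (resolvent (sysA S2)) (map_mx _ Q)
  (map_mx _ (sysB S1)) (map_mx _ (sysC S2)) => r1 r2 q b c Qres.
by rewrite -(mulmxA c q) Qres !mulmxA.
Qed.

(** Since (-sI - A)^T = -(sI + A^T), inversion leaves one minus sign, which the input matrix -C^T of
    the adjoint absorbs. *)
Lemma transfer_adjoint (R : realType) (n m : nat) (A : 'M[R]_n)
    (B : 'M[R]_(n, m)) (C : 'M[R]_(m, n)) (D : 'M[R]_m) :
  transfer (System (- A^T) (- C^T) B^T D^T) (ratvar R) =
  (transfer (System A B C D) (- ratvar R))^T.
Proof.
rewrite /transfer /= linearD /= !trmx_mul trmx_inv !map_trmx; congr (_ + _).
have U := ratvar_sub_unitmx (- A^T).
set M := _ - _ in U *.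
have -> : ((- ratvar R)%:M - map_mx (@ratconst R) A)^T = -1 *: M.
  rewrite /M scaleN1r opprB raddfB /= tr_scalar_mx [in LHS]raddfN /= [LHS]addrC.
  by rewrite map_mxN map_trmx.
have UN : -1 *: M \in unitmx by rewrite unitmxZ ?unitrN1.
rewrite (invmxZ UN) invrN1 scaleN1r map_mxN.
by rewrite mulmxN mulNmx mulmxN mulmxA.
Qed.

Lemma io_hamiltonianP (R : realType) (n m : nat) (A : 'M[R]_n)
    (B : 'M[R]_(n, m)) (C : 'M[R]_(m, n)) (D : 'M[R]_m) :
  io_hamiltonian 1%:M (System A B C D) <->
  transfer (System A B C D) (ratvar R) =
  transfer (System (- A^T) (- C^T) B^T D^T) (ratvar R).
Proof. by rewrite /io_hamiltonian map_mx1 mul1mx mulmx1 transfer_adjoint. Qed.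

(** * State trajectories *)

Lemma continuous_matrix (T : topologicalType) (R : realType) (p q : nat)
    (f : T -> 'M[R]_(p, q)) :
  (forall i j, continuous (fun t => f t i j)) -> continuous f.
Proof.
move=> cf t A [P Pf PA]; near=> s; apply: PA => i j.
move: i j; near: s; apply: filter_forall => i; apply: filter_forall => j.
exact/cf/Pf.
Unshelve. all: by end_near. Qed.

Lemma continuous_entry (T : topologicalType) (R : realType) (p q : nat)
    (f : T -> 'M[R]_(p, q)) (t : T) i j :
  {for t, continuous f} -> {for t, continuous (fun s => f s i j)}.
Proof.
move=> cf; apply: (@continuous_comp _ _ _ f (fun M : 'M[R]_(p, q) => M i j)) => //.
exact: coord_continuous.
Qed.

Lemma cvg_mulmx_entry (T : Type) (F : set_system T) (R : realType) (p q r : nat)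
    (M : 'M[R]_(p, q)) (f : T -> 'M[R]_(q, r)) (l : 'M[R]_(q, r)) i j :
  Filter F -> (forall k, f t k j @[t --> F] --> l k j) ->
  (M *m f t) i j @[t --> F] --> (M *m l) i j.
Proof.
move=> FF cf; rewrite mxE.
rewrite (_ : (fun t => _) = (fun t => \sum_k M i k * f t k j)); last first.
  by apply/funext => t; rewrite mxE.
apply: (@cvg_big _ _ _ _ _ (@add_continuous R)) => k _.
exact: cvgMl_tmp.
Qed.

Lemma continuous_mulmx (T : topologicalType) (R : realType) (p q r : nat)
    (M : 'M[R]_(p, q)) (f : T -> 'M[R]_(q, r)) :
  continuous f -> continuous (fun t => M *m f t).
Proof.
move=> cf; apply: continuous_matrix => i j t.
by apply: cvg_mulmx_entry => k; apply: continuous_entry; exact: cf.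
Qed.

Lemma cvg_entry (T : Type) (F : set_system T) (R : realType) (p q : nat)
    (f : T -> 'M[R]_(p, q)) (l : 'M[R]_(p, q)) i j :
  Filter F -> f t @[t --> F] --> l -> f t i j @[t --> F] --> l i j.
Proof.
move=> FF fl; apply: (@cvg_comp _ _ _ f (fun M : 'M[R]_(p, q) => M i j)) fl _.
exact: coord_continuous.
Qed.

Lemma cvg_mulmxD_entry (T : Type) (F : set_system T) (R : realType)
    (p q1 q2 r : nat) (M : 'M[R]_(p, q1)) (N : 'M[R]_(p, q2))
    (f : T -> 'M[R]_(q1, r)) (g : T -> 'M[R]_(q2, r))
    (lf : 'M[R]_(q1, r)) (lg : 'M[R]_(q2, r)) i j :
  Filter F -> (forall k, f t k j @[t --> F] --> lf k j) ->
  (forall k, g t k j @[t --> F] --> lg k j) ->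
  (M *m f t + N *m g t) i j @[t --> F] --> (M *m lf + N *m lg) i j.
Proof.
move=> FF cf cg; rewrite mxE; under eq_fun do rewrite mxE.
by apply: cvgD; exact: cvg_mulmx_entry.
Qed.

Lemma bounded_itv_Lfun2 (R : realType) (f : R -> R) (a b M : R) :
  measurable_fun setT f -> (forall t, `|f t| <= M) ->
  (forall t, t \notin `[a, b] -> f t = 0) ->
  f \in Lfun (@lebesgue_measure R) 2%:E.
Proof.
move=> mf fM f0; rewrite inE; apply/andP; split; rewrite inE //=.
rewrite /finite_norm unlock /Lnorm; apply: poweR_lty.
have M0 : 0 <= M by exact: le_trans (normr_ge0 _) (fM 0).
apply: (@le_lt_trans _ _ (\int[lebesgue_measure]_(t in `[a, b]) (cst (M ^+ 2)%:E) t)%E).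
  rewrite [leRHS]integral_mkcond; apply: ge0_le_integral => //.
  - by move=> t _; rewrite poweR_ge0.
  - apply/measurable_EFinP.
    apply: (@measurableT_comp _ _ _ _ _ _ (@powR R ^~ 2)); first exact: measurable_powR.
    exact: measurableT_comp.
  - by apply/(measurable_restrictT _ _).1 => //; exact: measurable_cst.
  move=> t _; rewrite patchE; case: ifPn => [_|tab] /=.
    rewrite powR_mulrn // lee_fin lerXn2r // nnegrE //.
  by rewrite f0 ?normr0 ?powR0 //; move: tab; apply: contra => ?; exact/mem_set.
rewrite integral_cst //= lebesgue_measure_itv /=.
by case: ifPn => _; rewrite -?EFinB -?EFinM ?ltry ?mule0 ?ltry.
Qed.

(** On a bounded interval f is its product with the indicator, and a product of two L2 functions is
    in L1. *)
Lemma Lfun2_integrable_itv (R : realType) (f : R -> R) (a b : R) :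
  f \in Lfun (@lebesgue_measure R) 2%:E ->
  (@lebesgue_measure R).-integrable `[a, b] (EFin \o f).
Proof.
move=> f2; apply/integrable_mkcond => //.
rewrite restrict_EFin patch_indic; apply/Lfun1_integrable.
apply: Lfun2_mul_Lfun1 => //; apply: (@bounded_itv_Lfun2 _ _ a b 1).
- exact: measurable_indic.
- by move=> t; rewrite indicE; case: (_ \in _); rewrite ?normr1 ?normr0.
- by move=> t tab; rewrite indicE memNset //=; apply/negP.
Qed.

Lemma integrable_mulmx (R : realType) (p q : nat) (M : 'M[R]_(p, q))
    (f : R -> 'cV[R]_q) (a b : R) :
  (forall j, (@lebesgue_measure R).-integrable `[a, b]
     (EFin \o (fun t => f t j 0))) ->
  forall i, (@lebesgue_measure R).-integrable `[a, b]
     (EFin \o (fun t => (M *m f t) i 0)).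
Proof.
move=> fi i.
rewrite (_ : _ \o _ = (fun t =>
    \sum_j ((M i j)%:E * (EFin \o (fun t => f t j 0%R)) t)%E)).
  apply: integrable_sum => // j _; exact: integrableZl.
by apply/funext => t /=; rewrite mxE sumEFin.
Qed.

Lemma mulmx_vintegral (R : realType) (p q : nat) (M : 'M[R]_(p, q))
    (f : R -> 'cV[R]_q) (a b : R) :
  (forall j, (@lebesgue_measure R).-integrable `[a, b]
     (EFin \o (fun t => f t j 0))) ->
  M *m vintegral a b f = vintegral a b (fun t => M *m f t).
Proof.
move=> fi; apply/colP => i; rewrite !mxE /Rintegral.
rewrite (_ : (fun t => _%:E) = (fun t =>
    \sum_j ((M i j)%:E * (EFin \o (fun t => f t j 0%R)) t)%E)); last first.
  by apply/funext => t /=; rewrite mxE sumEFin.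
rewrite integral_sum // => [|j]; last exact: integrableZl.
rewrite -sum_fine => [|j _]; last first.
  by apply: integrable_fin_num => //; exact: integrableZl.
by apply: eq_bigr => j _; rewrite mxE -RintegralZl.
Qed.

Lemma trajectory_integrable (R : realType) (n m : nat) (S : system R n m)
    (u : R -> 'cV[R]_m) (x : R -> 'cV[R]_n) (a b : R) :
  L2_signal u -> state_trajectory S u x ->
  forall i, (@lebesgue_measure R).-integrable `[a, b]
    (EFin \o (fun t => (sysA S *m x t + sysB S *m u t) i 0)).
Proof.
move=> u2 [cx _] i.
rewrite (_ : _ \o _ = (EFin \o (fun t => (sysA S *m x t)%R i 0%R)) \+
  (EFin \o (fun t => (sysB S *m u t)%R i 0%R)))%E; last first.
  by apply/funext => t /=; rewrite mxE.
apply: integrableD => //; apply: integrable_mulmx => j.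
  apply: continuous_compact_integrable; first exact: segment_compact.
  by apply: continuous_subspaceT => t; apply: continuous_entry; exact: cx.
exact: Lfun2_integrable_itv.
Qed.

Lemma trajectory_functional (R : realType) (n m q : nat) (S : system R n m)
    (u : R -> 'cV[R]_m) (x : R -> 'cV[R]_n) (M : 'M[R]_(q, n)) (a b : R) :
  L2_signal u -> state_trajectory S u x -> a <= b ->
  M *m x b = M *m x a +
    vintegral a b (fun t => M *m (sysA S *m x t + sysB S *m u t)).
Proof.
move=> u2 xS ab; rewrite (proj2 xS a b ab) mulmxDr mulmx_vintegral //.
exact: trajectory_integrable.
Qed.

Lemma similar_trajectory (R : realType) (n m : nat) (S1 S2 : system R n m)
    (Q : 'M[R]_n) (u : R -> 'cV[R]_m) (x : R -> 'cV[R]_n) :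
  Q *m sysA S1 = sysA S2 *m Q -> Q *m sysB S1 = sysB S2 ->
  L2_signal u -> state_trajectory S1 u x ->
  state_trajectory S2 u (fun t => Q *m x t).
Proof.
move=> QA QB u2 xS; split; first exact/continuous_mulmx/(proj1 xS).
move=> a b ab; rewrite (trajectory_functional _ u2 xS ab); congr (_ + vintegral _ _ _).
by apply/funext => t; rewrite mulmxDr !mulmxA QA QB.
Qed.

(** The fundamental theorem of calculus applied to the integral form. Continuity is asked only of
    the observed combination M(Ax + Bu) at t, so a discontinuous input is allowed when M B = 0. *)
Lemma trajectory_is_derive (R : realType) (n m q : nat) (S : system R n m)
    (u : R -> 'cV[R]_m) (x : R -> 'cV[R]_n) (M : 'M[R]_(q, n)) (t : R) i :
  let f := fun s => (M *m (sysA S *m x s + sysB S *m u s)) i 0 in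
  L2_signal u -> state_trajectory S u x -> {for t, continuous f} ->
  is_derive t 1 (fun s => (M *m x s) i 0) (f t).
Proof.
move=> f u2 xS cf.
have tt1 : t < t + 1 by rewrite ltrDl.
have t1t : t - 1 < t by rewrite ltrBlDr ltrDl.
have fi : (@lebesgue_measure R).-integrable `[t - 1, t + 1] (EFin \o f).
  by apply: integrable_mulmx => j; exact: trajectory_integrable.
have [dF Ff] := continuous_FTC1_closed tt1 fi t1t cf.
set F := (fun y => _) in dF Ff.
have Fd : is_derive t 1 F (f t) by rewrite -Ff derive1E; exact/derivableP.
have : is_derive t 1 (cst ((M *m x (t - 1)) i 0) + F) (f t).
  by rewrite -[f t]add0r; exact: is_deriveD.
apply: near_eq_is_derive; near=> s.
have ts : t - 1 <= s by rewrite ltW //; near: s; exact: lt_nbhsr.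
by rewrite (trajectory_functional M u2 xS ts) [RHS]mxE [vintegral _ _ _ i 0]mxE.
Unshelve. all: by end_near. Qed.

(** * Controllability and observability *)

(** Both g + f and g - f are nondecreasing on [0, T] and start at 0. *)
Lemma norm_le_derive (R : realType) (f df g dg : R -> R) (T : R) :
  (forall t : R, is_derive t 1 f (df t)) -> (forall t : R, is_derive t 1 g (dg t)) ->
  f 0 = 0 -> g 0 = 0 -> (forall t, 0 <= t <= T -> `|df t| <= dg t) ->
  forall t, 0 <= t <= T -> `|f t| <= g t.
Proof.
move=> fd gd f0 g0 dfg t /andP[t0 tT].
have mono (h dh : R -> R) : (forall s : R, is_derive s 1 h (dh s)) -> h 0 = 0 ->
    (forall s, 0 <= s <= T -> 0 <= dh s) -> 0 <= h t.
  move=> hd h0 dh0; rewrite -h0.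
  apply: (@ger0_derive1_ndecr _ h 0 T) => //.
  - by move=> s; rewrite in_itv /= => /andP[s0 sT]; rewrite derive1E derive_val dh0 ?ltW.
  - apply: continuous_subspaceT => s; apply: differentiable_continuous.
    by apply/derivable1_diffP.
rewrite ler_norml; apply/andP; split.
- rewrite -subr_ge0 opprK; apply: (mono (f + g) (fun s => df s + dg s)).
  + by rewrite /= !fctE f0 g0 addr0.
  + move=> s /dfg; rewrite ler_norml => /andP[+ _].
    by rewrite -subr_ge0 opprK.
- rewrite -subr_ge0; apply: (mono (g - f) (fun s => dg s - df s)).
  + by rewrite /= !fctE f0 g0 subr0.
  + by move=> s /dfg; rewrite ler_norml subr_ge0 => /andP[].
Qed.

(** Integrating the bound on f_(k+j) down j times gives M c^(k+j) t^j / j! as a bound for f_k. For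
    fixed k this tends to 0 as j grows, being a constant times a term of the series of exp(ct). *)
Lemma derive_chain_eq0 (R : realType) (f : nat -> R -> R) (c M T : R) :
  (forall k (t : R), is_derive t 1 (f k) (f k.+1 t)) -> (forall k, f k 0 = 0) ->
  0 <= T -> (forall k t, 0 <= t <= T -> `|f k t| <= M * c ^+ k) ->
  forall k, f k T = 0.
Proof.
move=> fd f0 T0 fM k.
have bound j : forall k t, 0 <= t <= T ->
    `|f k t| <= M * c ^+ (k + j) * t ^+ j / j`!%:R.
  elim: j => [|j IHj] {}k t tT.
    by rewrite addn0 expr0 mulr1 fact0 divr1 fM.
  apply: (norm_le_derive (df := f k.+1)
    (g := fun t => M * c ^+ (k + j.+1) * t ^+ j.+1 / j.+1`!%:R)
    (dg := fun t => M * c ^+ (k.+1 + j) * t ^+ j / j`!%:R)) tT => //.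
  - move=> s.
    have -> : (fun t => M * c ^+ (k + j.+1) * t ^+ j.+1 / j.+1`!%:R) =
        (M * c ^+ (k + j.+1) / j.+1`!%:R) \*: (@GRing.exp R ^~ j.+1).
      by apply/funext => r /=; rewrite mulrAC.
    have -> : M * c ^+ (k.+1 + j) * s ^+ j / j`!%:R =
        (M * c ^+ (k + j.+1) / j.+1`!%:R) *: ((j.+1%:R * s ^+ j) *: 1).
      rewrite addSnnS factS natrM /GRing.scale /= mulr1.
      field.
      by rewrite -[1 + _](natrD _ 1) !pnatr_eq0 -lt0n fact_gt0.
    have -> : @GRing.exp R ^~ j.+1 = (id : R -> R) ^+ j.+1.
      by rewrite exprfctE.
    by apply: is_deriveZ; exact: (is_deriveX j.+1).
  - by rewrite expr0n mulr0 mul0r.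
  - by move=> s sT; exact: IHj.
apply/eqP; rewrite -normr_le0.
have : (fun j => (M * c ^+ k) * exp_coeff (c * T) j) @ \oo --> (M * c ^+ k) * 0.
  by apply: cvgMl_tmp; exact: cvg_exp_coeff.
rewrite mulr0 => cv0; rewrite -(cvg_lim _ cv0) //.
apply: limr_ge; first by apply/cvg_ex; exists 0.
apply: nearW => j; have := bound j k T; rewrite T0 lexx => /(_ isT).
by rewrite /exp_coeff /= exprD exprMn !mulrA.
Qed.

Lemma expmx_bound (R : realType) (n : nat) (A : 'M[R]_n) :
  exists2 c : R, 0 <= c & forall k i j, `|(A ^+ k) i j| <= c ^+ k.
Proof.
pose c := \sum_i \sum_j `|A i j|.
have c0 : 0 <= c by apply: sumr_ge0 => i _; exact: sumr_ge0.
exists c => // k; elim: k => [|k IHk] i j.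
  by rewrite !expr0 mxE; case: (_ == _); rewrite ?normr1 ?normr0.
rewrite exprS -mulmxE mxE exprS.
apply: le_trans (ler_norm_sum _ _ _) _.
apply: (@le_trans _ _ (\sum_l `|A i l| * c ^+ k)).
  by apply: ler_sum => l _; rewrite normrM ler_wpM2l.
rewrite -mulr_suml ler_wpM2r ?exprn_ge0 // /c [leRHS](bigD1 i) //= lerDl.
by apply: sumr_ge0 => l _; exact: sumr_ge0.
Qed.

(* The functions f_k = w A^k x satisfy f_k' = f_(k+1) and vanish at 0, while
   |f_k| grows at most geometrically in k, so they are identically 0. *)
Lemma controllable_annihilator (R : realType) (n m : nat) (S : system R n m)
    (w : 'rV[R]_n) :
  controllable S -> (forall k, w *m sysA S ^+ k *m sysB S = 0) -> w = 0.
Proof.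
move=> ctrl wAB.
(* The target state [w^T] makes w x(T) the sum of the squares of the entries of w. *)
have [T [u [x [T0 u2 xS x0 xT]]]] := ctrl 0 w^T.
pose f k t := (w *m sysA S ^+ k *m x t) 0 0.
have fE k t : (w *m sysA S ^+ k *m (sysA S *m x t + sysB S *m u t)) 0 0 = f k.+1 t.
  by rewrite mulmxDr !mulmxA wAB mul0mx addr0 /f exprSr -mulmxE !mulmxA.
have fd k (t : R) : is_derive t 1 (f k) (f k.+1 t).
  rewrite -fE.
  apply: (@trajectory_is_derive _ _ _ _ S u x (w *m sysA S ^+ k) t 0 u2 xS).
  have cf : continuous (f k.+1).
    move=> r; apply: (@continuous_entry _ _ _ _
      (fun t => w *m sysA S ^+ k.+1 *m x t)).
    exact: continuous_mulmx (proj1 xS) r.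
  by move: cf; rewrite -(funext (fE k)); apply.
have f0 k : f k 0 = 0 by rewrite /f x0 mulmx0 mxE.
have [c c0 Ac] := expmx_bound (sysA S).
(* The continuous state has bounded 1-norm on [0, T]; its maximum supplies the constant of the
   geometric bound. *)
have [d _ dmax] : exists2 d : R, d \in `[0, T] &
    forall t, t \in `[0, T] -> \sum_i `|x t i 0| <= \sum_i `|x d i 0|.
  apply: EVT_max; first exact: ltW.
  apply: continuous_subspaceT => t.
  apply: (@cvg_big _ _ _ _ _ (@add_continuous R)) => i _.
  by apply: cvg_norm; apply: continuous_entry; exact: (proj1 xS).
have : f 0 T = 0.
  apply: (@derive_chain_eq0 _ f c ((\sum_j `|w 0 j|) * \sum_i `|x d i 0|)) => //.
    exact: ltW.
  move=> k t tT; rewrite /f mxE.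
  apply: le_trans (ler_norm_sum _ _ _) _.
  apply: (@le_trans _ _ (\sum_i ((\sum_j `|w 0 j|) * c ^+ k) * `|x t i 0|)).
    apply: ler_sum => i _; rewrite normrM ler_wpM2r // mxE.
    apply: le_trans (ler_norm_sum _ _ _) _.
    by rewrite mulr_suml; apply: ler_sum => j _; rewrite normrM ler_wpM2l.
  rewrite -mulr_sumr mulrAC ler_wpM2r ?exprn_ge0 //.
  by rewrite ler_wpM2l ?sumr_ge0 // dmax // in_itv.
rewrite /f expr0 mulmx1 xT mxE => /eqP.
rewrite psumr_eq0 => [/allP w0|j _]; last by rewrite mxE -expr2 sqr_ge0.
apply/rowP => j; have := w0 j; rewrite mem_index_enum !mxE mulf_eq0 orbb.
by move=> /(_ isT) /eqP.
Qed.

(** * Exponential series and free motions *)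

(** For [a k = (A ^+ k *m v) i 0] this is the i-th entry of exp(tA) v. Differentiation in t amounts
    to shifting [a]. *)
Definition exp_series (R : realType) (a : nat -> R) (t : R) : R :=
  limn (pseries (fun k => a k / k`!%:R) t).

Definition exp_bounded (R : realType) (a : nat -> R) :=
  exists M c : R, [/\ 0 <= M, 0 <= c & forall k, `|a k| <= M * c ^+ k].

Lemma exp_bounded_shift (R : realType) (a : nat -> R) :
  exp_bounded a -> exp_bounded (fun k => a k.+1).
Proof.
move=> [M [c [M0 c0 aMc]]]; exists (M * c), c; split=> //; first exact: mulr_ge0.
by move=> k; rewrite -mulrA -exprS.
Qed.

Lemma exp_bounded_cvg (R : realType) (a : nat -> R) (t : R) :
  exp_bounded a -> cvgn (pseries (fun k => a k / k`!%:R) t).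
Proof.
move=> [M [c [M0 c0 aMc]]]; apply: normed_cvg.
apply: (@series_le_cvg _ _ (fun k => M * exp_coeff (c * `|t|) k)).
- by move=> k /=.
- by move=> k; rewrite mulr_ge0 // exp_coeff_ge0 // mulr_ge0.
- move=> k /=; rewrite /exp_coeff /= !normrM normfV normrX (ger0_norm (ler0n _ _)).
  rewrite exprMn !mulrA mulrAC ler_wpM2r ?invr_ge0 //.
  by rewrite ler_wpM2r ?exprn_ge0.
- exact: is_cvg_seriesZ (is_cvg_series_exp_coeff _).
Qed.

Lemma exp_series0 (R : realType) (a : nat -> R) : exp_series a 0 = a 0%N.
Proof.
apply: cvg_lim => //; rewrite -(cvg_shiftS (pseries _ _)).
rewrite (_ : (fun _ => _) = cst (a 0%N)); first exact: cvg_cst.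
apply/funext => k; rewrite /pseries /series /= big_nat_recl //.
rewrite expr0 mulr1 fact0 divr1 big1 ?addr0 // => i _.
by rewrite expr0n mulr0.
Qed.

Lemma exp_series_is_derive (R : realType) (a : nat -> R) (t : R) :
  exp_bounded a -> is_derive t 1 (exp_series a) (exp_series (fun k => a k.+1) t).
Proof.
move=> ab; have diffE (b : nat -> R) :
    pseries_diffs (fun k => b k / k`!%:R) = fun k => b k.+1 / k`!%:R.
  apply/funext => k; rewrite /pseries_diffs factS natrM invfM mulrCA mulVKf //.
(* Termwise differentiation needs convergence of the series and of its first two formal derivatives
   at a point of modulus larger than |t|. *)
have t1 : `|t| < `|(`|t| + 1)| by rewrite [ltRHS]ger0_norm // ltrDl.
have := @pseries_snd_diffs _ (fun k => a k / k`!%:R) (`|t| + 1) t.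
rewrite !diffE; apply=> //.
- exact: exp_bounded_cvg.
- by apply: (@exp_bounded_cvg _ (fun k => a k.+1)); exact: exp_bounded_shift.
- apply: (@exp_bounded_cvg _ (fun k => a k.+2)).
  exact/(@exp_bounded_shift _ (fun k => a k.+1))/exp_bounded_shift.
Qed.

Lemma exp_series_linear (R : realType) (q : nat) (c : 'I_q -> R)
    (a : 'I_q -> nat -> R) (t : R) :
  (forall j, exp_bounded (a j)) ->
  exp_series (fun k => \sum_j c j * a j k) t = \sum_j c j * exp_series (a j) t.
Proof.
move=> ab; apply: cvg_lim => //.
rewrite (_ : pseries _ _ =
    (fun N => \sum_j c j * pseries (fun k => a j k / k`!%:R) t N)).
  apply: (@cvg_big _ _ _ _ _ (@add_continuous R)) => j _; apply: cvgMl_tmp.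
  exact: exp_bounded_cvg.
apply/funext => N; rewrite /pseries /series /=.
under [RHS]eq_bigr do rewrite mulr_sumr.
rewrite exchange_big; apply: eq_bigr => k _ /=.
by rewrite !mulr_suml; apply: eq_bigr => j _; rewrite !mulrA.
Qed.

Lemma is_derive_vintegral (R : realType) (n : nat) (x f : R -> 'cV[R]_n) (a b : R) :
  (forall (t : R) i, is_derive t 1 (fun s => x s i 0) (f t i 0)) ->
  (forall i, continuous (fun s => f s i 0)) -> a <= b ->
  x b = x a + vintegral a b f.
Proof.
move=> xf cf; rewrite le_eqVlt => /orP[/eqP <-|ab]; apply/colP => i; rewrite !mxE.
  by rewrite set_itv1 Rintegral_set1 addr0.
rewrite /Rintegral (@continuous_FTC2 _ _ (fun s => x s i 0)) //.
- by rewrite -EFinB /= subrKC.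
- exact: continuous_subspaceT.
- have cx : continuous (fun s => x s i 0).
    by move=> s; apply: differentiable_continuous; apply/derivable1_diffP.
  split=> [s _||]; first by [].
    by apply: cvg_at_right_filter; exact: cx.
  by apply: cvg_at_left_filter; exact: cx.
- by move=> s _; rewrite derive1E derive_val.
Qed.

Lemma L2_signal0 (R : realType) (k : nat) : L2_signal (fun _ : R => 0 : 'cV[R]_k).
Proof.
move=> i; apply: (@bounded_itv_Lfun2 _ _ 0 0 0).
- by under eq_fun do rewrite mxE; exact: measurable_cst.
- by move=> t; rewrite mxE normr0.
- by move=> t _; rewrite mxE.
Qed.

(** The free motion x(t) = exp(tA) v has output equal to the series of C A^k v t^k / k!, hence 0. It
    is therefore indistinguishable from the zero motion, and its initial state v is 0. *)
Lemma observable_annihilator (R : realType) (n m : nat) (S : system R n m)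
    (v : 'cV[R]_n) :
  observable S -> (forall k, sysC S *m sysA S ^+ k *m v = 0) -> v = 0.
Proof.
move=> obs CAv; pose A := sysA S.
pose a i k := (A ^+ k *m v) i 0.
have ab i : exp_bounded (a i).
  have [c c0 Ac] := expmx_bound A.
  exists (\sum_j `|v j 0|), c; split=> // [|k]; first exact: sumr_ge0.
  rewrite /a mxE; apply: le_trans (ler_norm_sum _ _ _) _.
  by rewrite mulr_suml; apply: ler_sum => j _; rewrite normrM mulrC ler_wpM2l.
pose x t := \col_i exp_series (a i) t : 'cV[R]_n.
have Mx q (M : 'M[R]_(q, n)) t i :
    (M *m x t) i 0 = exp_series (fun k => (M *m A ^+ k *m v) i 0) t.
  rewrite (_ : (fun k => _) = fun k => \sum_j M i j * a j k); last first.
    by apply/funext => k; rewrite -mulmxA mxE.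
  by rewrite exp_series_linear // mxE; apply: eq_bigr => j _; rewrite mxE.
have xd (t : R) i : is_derive t 1 (fun s => x s i 0) ((A *m x t) i 0).
  rewrite (_ : (fun s => x s i 0) = exp_series (a i)); last first.
    by apply/funext => s; rewrite mxE.
  rewrite Mx (_ : (fun k => _) = (fun k => a i k.+1)).
    exact: exp_series_is_derive.
  by apply/funext => k; rewrite /a exprS -mulmxE.
have cx : continuous x.
  apply: continuous_matrix => i j t; rewrite (ord1 j).
  by apply: differentiable_continuous; apply/derivable1_diffP.
have u0 : L2_signal (fun _ : R => 0 : 'cV[R]_m) by exact: L2_signal0.
have cAx i : continuous (fun s => (A *m x s) i 0).
  move=> r; apply: (@continuous_entry _ _ _ _ (fun s => A *m x s)).
  exact: continuous_mulmx.
have xS : state_trajectory S (fun _ => 0) x.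
  split=> // s t st; rewrite mulmx0; under eq_fun do rewrite addr0.
  exact: is_derive_vintegral.
have zS : state_trajectory S (fun _ : R => 0) (fun _ => 0).
  split=> [t|s t st]; first exact: cvg_cst.
  rewrite !mulmx0 addr0 /vintegral; apply/colP => i; rewrite !mxE add0r.
  by rewrite Rintegral_cst // mul0r.
have x0 : x 0 = v.
  by apply/colP => i; rewrite mxE exp_series0 /a expr0 mul1mx.
rewrite -x0; apply: (obs _ _ _ u0 xS zS) => t _.
rewrite /output !mulmx0 !addr0; apply/colP => i; rewrite Mx mxE.
(* The zero sequence is written as an empty sum, so that linearity with no terms evaluates its
   series. *)
rewrite (_ : (fun k => _) = (fun k => \sum_(j < 0) 0 * 0)); last first.
  by apply/funext => k; rewrite CAv mxE big_ord0.
by rewrite (@exp_series_linear _ 0 (fun=> 0) (fun _ _ => 0)) ?big_ord0 // => -[].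
Qed.

(** * Transitions from rest to rest *)

Definition cutoff (R : realType) (k : nat) (f : R -> 'cV[R]_k) (t : R) : 'cV[R]_k :=
  if 0 <= t <= 1 then f t else 0.

Lemma cutoff_mulmx (R : realType) (p k : nat) (M : 'M[R]_(p, k))
    (f : R -> 'cV[R]_k) (t : R) :
  M *m cutoff f t = cutoff (fun s => M *m f s) t.
Proof. by rewrite /cutoff; case: ifP; rewrite ?mulmx0. Qed.

Lemma cutoffD (R : realType) (k : nat) (f g : R -> 'cV[R]_k) (t : R) :
  cutoff f t + cutoff g t = cutoff (fun s => f s + g s) t.
Proof. by rewrite /cutoff; case: ifP; rewrite ?addr0. Qed.

Lemma cutoff_entry (R : realType) (k : nat) (f : R -> 'cV[R]_k) i :
  (fun t => cutoff f t i 0) = (fun t => f t i 0) \_ `[0, 1].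
Proof.
apply/funext => t; rewrite patchE /cutoff mem_setE in_itv /=.
by case: ifP; rewrite ?mxE.
Qed.

Lemma cutoff_L2 (R : realType) (k : nat) (f : R -> 'cV[R]_k) :
  continuous f -> L2_signal (cutoff f).
Proof.
move=> cf i.
have cfi : continuous (fun t => f t i 0) by move=> t; exact/continuous_entry/cf.
have [M _ fM] : exists2 M : R, M \in `[0, 1] &
    forall t, t \in `[0, 1] -> `|f t i 0| <= `|f M i 0|.
  apply: EVT_max => //; apply: continuous_subspaceT => t.
  by apply: cvg_norm; exact: cfi.
rewrite cutoff_entry; apply: (@bounded_itv_Lfun2 _ _ 0 1 `|f M i 0|).
- apply/(measurable_restrictT _ _).1 => //.
  by apply: measurable_funTS; exact: continuous_measurable_fun.
- by move=> t; rewrite patchE mem_setE; case: ifPn => [/fM//|_]; rewrite normr0.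
- by move=> t tn; rewrite patchE mem_setE (negPf tn).
Qed.

Lemma cutoff_compact_support (R : realType) (k : nat) (f : R -> 'cV[R]_k) :
  compact_support (cutoff f).
Proof.
exists 1; apply: aeW => t; rewrite /cutoff; case: ifP => // /andP[t0 t1].
by rewrite ger0_norm // ltNge t1.
Qed.

(** A motion from rest to rest extends by rest: vanishing at 0 and 1 prevents jumps of the state,
    while the input may jump there. *)
Lemma cutoff_trajectory (R : realType) (n m : nat) (S : system R n m)
    (X : R -> 'cV[R]_n) (U : R -> 'cV[R]_m) :
  (forall (t : R) i, is_derive t 1 (fun s => X s i 0)
                       ((sysA S *m X t + sysB S *m U t) i 0)) ->
  continuous U -> X 0 = 0 -> X 1 = 0 ->
  state_trajectory S (cutoff U) (cutoff X).
Proof.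
move=> XU cU X0 X1.
have cX : continuous X.
  apply: continuous_matrix => i j t; rewrite (ord1 j).
  by apply: differentiable_continuous; apply/derivable1_diffP.
pose F t := sysA S *m X t + sysB S *m U t.
have cF i : continuous (fun t => F t i 0).
  rewrite (_ : (fun t => F t i 0) = (fun t => (sysA S *m X t) i 0) +
                                 (fun t => (sysB S *m U t) i 0)).
    by move=> t; apply: cvgD;
      apply: cvg_mulmx_entry => j; apply: continuous_entry; [exact: cX|exact: cU].
  by apply/funext => t; rewrite /F mxE.
(* Because X vanishes at 0 and at 1, cutting off agrees with clamping the time to [0, 1], and this
   form is visibly continuous. *)
have cutE : cutoff X = (fun t => X (Num.max 0 (Num.min t 1))).
  apply/funext => t; rewrite /cutoff /Num.max /Num.min.
  case: (ltrP t 1) => t1; last by rewrite ltr01 X1; case: ifP => // /andP[_ t1'];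
    rewrite -X1; congr X; apply/le_anti; rewrite t1 t1'.
  by rewrite (ltW t1) andbT; case: (ltrgt0P t) => // ->.
split.
  rewrite cutE => t; apply: (@continuous_comp _ _ _
    (fun t : R => Num.max 0 (Num.min t 1)) X); last exact: cX.
  by apply: continuous_max; [exact: cvg_cst|apply: continuous_min => //; exact: cvg_cst].
move=> a b ab.
rewrite (_ : (fun t => _) = cutoff F); last first.
  by apply/funext => t; rewrite !cutoff_mulmx cutoffD.
have intE : vintegral a b (cutoff F) = vintegral (Num.max a 0) (Num.min b 1) F.
  apply/colP => i; rewrite !mxE cutoff_entry -Rintegral_mkcondr.
  congr Rintegral; apply/seteqP; split=> t /=; rewrite !in_itv /= ge_max le_min.
    by move=> [/andP[-> ->] /andP[-> ->]].
  by move=> /andP[/andP[-> ->] /andP[-> ->]].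
rewrite intE; case: (lerP (Num.max a 0) (Num.min b 1)) => abE.
  rewrite -[LHS](subrK (cutoff X a)) addrC; congr (_ + _).
  apply/eqP; rewrite subr_eq addrC; apply/eqP.
  rewrite !cutE.
  have -> : Num.max 0 (Num.min b 1) = Num.min b 1.
    by apply/max_idPr; apply: le_trans abE; rewrite le_max lexx orbT.
  have -> : Num.max 0 (Num.min a 1) = Num.max a 0.
    move: abE; rewrite le_min !ge_max => /andP[_ /andP[a1 _]].
    by rewrite (min_idPl a1) maxC.
  exact: is_derive_vintegral.
(* Here [a, b] misses [0, 1]: the integral is 0, and the state is at rest at both ends. *)
have -> : vintegral (Num.max a 0) (Num.min b 1) F = 0.
  by apply/colP => i; rewrite !mxE set_itv_ge ?Rintegral_set0 // bnd_simp -ltNge.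
rewrite addr0 /cutoff.
have -> : 0 <= b <= 1 = false.
  apply/negP => /andP[b0 b1]; move: abE.
  by rewrite (min_idPl b1) lt_max !ltNge ab b0.
have -> // : 0 <= a <= 1 = false.
apply/negP => /andP[a0 a1]; move: abE.
by rewrite (max_idPl a0) gt_min !ltNge ab a1.
Qed.

(** * Polynomial inputs that steer rest to rest *)

Lemma deriv_root_power (R : idomainType) (c : R) (k : nat) (g : {poly R}) :
  exists h, (('X - c%:P) ^+ k.+1 * g)^`() = ('X - c%:P) ^+ k * h.
Proof.
exists (g *+ k.+1 + ('X - c%:P) * g^`()).
rewrite derivM deriv_exp derivXsubC mul1r /= mulrDr exprSr -!mulrA; congr (_ + _).
by rewrite mulrnAl mulrnAr.
Qed.

(** Each differentiation lowers the multiplicity of the root c by at most one. *)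
Lemma derivn_root_power (R : idomainType) (c : R) (k j : nat) (g : {poly R}) :
  (j < k)%N -> ((('X - c%:P) ^+ k * g)^`(j)).[c] = 0.
Proof.
move=> ltjk.
suff [h ->] : exists h, (('X - c%:P) ^+ k * g)^`(j) = ('X - c%:P) ^+ (k - j) * h.
  by rewrite hornerM horner_exp hornerXsubC subrr expr0n subn_eq0 leqNgt ltjk mul0r.
elim: j ltjk => [|j IHj] ltjk; first by exists g; rewrite subn0.
have [h hE] := IHj (ltnW ltjk).
have [h' h'E] := deriv_root_power c (k - j.+1) h.
by exists h'; rewrite derivnS hE -h'E subnSK ?(ltnW ltjk).
Qed.

(** With s the shift of [d], this is the telescoping identity (s - A) sum_(k < i) s^(i-1-k) A^k =
    s^i - A^i, applied to b. *)
Lemma controller_form_step (R : comNzRingType) (n : nat) (A : 'M[R]_n)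
    (b : 'cV[R]_n) (d : nat -> R) (i : nat) :
  \sum_(k < i) d (i - k.+1).+1 *: (A ^+ k *m b) =
  A *m (\sum_(k < i) d (i - k.+1)%N *: (A ^+ k *m b)) + d i *: b
    - d 0%N *: (A ^+ i *m b).
Proof.
have -> : A *m (\sum_(k < i) d (i - k.+1)%N *: (A ^+ k *m b)) =
    \sum_(k < i) d (i - k.+1)%N *: (A ^+ k.+1 *m b).
  rewrite mulmx_sumr; apply: eq_bigr => k _.
  by rewrite -scalemxAr exprS -mulmxE mulmxA.
apply/eqP; rewrite eq_sym subr_eq; apply/eqP.
transitivity (\sum_(k < i.+1) d (i - k)%N *: (A ^+ k *m b)).
  by rewrite big_ord_recl subn0 expr0 mul1mx addrC.
rewrite big_ord_recr /= subnn; congr (_ + _); apply: eq_bigr => k _.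
by rewrite subnSK.
Qed.

(* With d i the i-th derivative of a scalar function, this is adj(d/dt - A) b
   applied to that function, since (chi(s) - chi(A)) / (s - A) = adj(s - A). *)
Definition controller_state (R : comNzRingType) (n : nat) (A : 'M[R]_n)
    (b : 'cV[R]_n) (d : nat -> R) : 'cV[R]_n :=
  \sum_(i < n.+1) (char_poly A)`_i *:
    \sum_(k < i) d (i - k.+1)%N *: (A ^+ k *m b).

(** Weighting the telescoping identity by the coefficients of the characteristic polynomial chi
    gives chi(s) - chi(A), and chi(A) = 0. Thus the state obeys x' = Ax + bu with u = chi(d/dt)
    applied to the scalar function. *)
Lemma controller_stateS (R : comNzRingType) (n : nat) (A : 'M[R]_n)
    (b : 'cV[R]_n) (d : nat -> R) :
  controller_state A b (fun j => d j.+1) =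
  A *m controller_state A b d + (\sum_(i < n.+1) (char_poly A)`_i * d i) *: b.
Proof.
rewrite /controller_state.
under eq_bigr do rewrite controller_form_step scalerBr scalerDr.
rewrite sumrB big_split /= -[RHS]subr0; congr (_ + _ - _).
- by rewrite mulmx_sumr; apply: eq_bigr => i _; rewrite -scalemxAr.
- by rewrite scaler_suml; apply: eq_bigr => i _; rewrite scalerA.
transitivity (d 0%N *: ((\sum_(i < n.+1) (char_poly A)`_i *: A ^+ i) *m b)).
  rewrite mulmx_suml scaler_sumr; apply: eq_bigr => i _.
  by rewrite -scalemxAl !scalerA mulrC.
by rewrite char_poly_power_eq0 mul0mx scaler0.
Qed.

Lemma controller_state0 (R : comNzRingType) (n : nat) (A : 'M[R]_n)
    (b : 'cV[R]_n) (d : nat -> R) :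
  (forall j, (j < n)%N -> d j = 0) -> controller_state A b d = 0.
Proof.
move=> d0; rewrite /controller_state big1 // => i _; rewrite big1 ?scaler0 // => k _.
rewrite d0 ?scale0r //; apply: leq_trans (leq_ord i).
by rewrite ltn_subrL /=; apply: leq_ltn_trans (ltn_ord k).
Qed.

(** One polynomial p serves both formulas, so differentiating the state in time is the same as
    shifting to the next derivatives of the scalar function. *)
Lemma controller_state_poly (R : comNzRingType) (n : nat) (A : 'M[R]_n)
    (b : 'cV[R]_n) (d : nat -> {poly R}) l :
  exists2 p : {poly R},
    (forall t, controller_state A b (fun j => (d j).[t]) l 0 = p.[t]) &
    (forall t, controller_state A b (fun j => ((d j)^`()).[t]) l 0 = (p^`()).[t]).
Proof.
pose P (f : nat -> {poly R}) := \sum_(i < n.+1) (char_poly A)`_i *: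
  \sum_(k < i) (A ^+ k *m b) l 0 *: f (i - k.+1)%N.
have PE f t : controller_state A b (fun j => (f j).[t]) l 0 = (P f).[t].
  rewrite summxE horner_sum; apply: eq_bigr => i _.
  rewrite mxE hornerZ summxE horner_sum; congr (_ * _); apply: eq_bigr => k _.
  by rewrite mxE hornerZ mulrC.
exists (P d) => // t; rewrite PE; congr (_.[t]).
have deriv_sum := big_morph (@deriv R) (@derivD R) (@deriv0 R).
rewrite /P deriv_sum; apply: eq_bigr => i _ /=.
by rewrite derivZ deriv_sum; congr (_ *: _); apply: eq_bigr => k _; rewrite derivZ.
Qed.

Lemma controller_transition (R : realType) (n m : nat) (S : system R n m)
    (v : 'cV[R]_m) :
  exists (U : R -> 'cV[R]_m) (X : R -> 'cV[R]_n), exists2 c : R, c != 0 &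
  [/\ forall (t : R) i, is_derive t 1 (fun s => X s i 0)
                          ((sysA S *m X t + sysB S *m U t) i 0),
      continuous U, X 0 = 0, X 1 = 0 & U 0 = c *: v].
Proof.
(* The state involves derivatives of [phi] of order below n only, so zeros of order n at 0 and 1 put
   it at rest there. *)
pose phi : {poly R} := ('X - 0%:P) ^+ n * ('X - 1%:P) ^+ n.
pose q : {poly R} := \sum_(i < n.+1) (char_poly (sysA S))`_i *: phi^`(i).
have phi0 j : (j < n)%N -> (phi^`(j)).[0] = 0 by exact: derivn_root_power.
have phi1 j : (j < n)%N -> (phi^`(j)).[1] = 0.
  by rewrite /phi mulrC; exact: derivn_root_power.
(* At 0 only the leading term i = n survives, and it equals n! times the coefficient (-1)^n of X^n
   in [phi]. *)
have q0 : q.[0] != 0.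
  rewrite horner_sum big_ord_recr /= big1 => [|i _]; last first.
    by rewrite hornerZ phi0 ?mulr0.
  rewrite add0r hornerZ char_poly_lead mul1r horner_coef0 coef_derivn addn0 ffactnn.
  rewrite /phi polyC0 subr0 coefXnM ltnn subnn -horner_coef0 horner_exp hornerXsubC.
  by rewrite sub0r -mulr_natr mulf_neq0 ?expf_neq0 ?oppr_eq0 ?oner_neq0 //
    pnatr_eq0 -lt0n fact_gt0.
exists (fun t => q.[t] *: v).
exists (fun t => controller_state (sysA S) (sysB S *m v) (fun j => (phi^`(j)).[t])).
exists q.[0] => //; split=> //.
- move=> t i.
  have [p pE dpE] := controller_state_poly (sysA S) (sysB S *m v)
    (fun j => phi^`(j)) i.
  rewrite (funext pE).
  have -> : sysB S *m (q.[t] *: v) =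
      (\sum_(i < n.+1) (char_poly (sysA S))`_i * (phi^`(i)).[t]) *: (sysB S *m v).
    by rewrite -scalemxAr horner_sum; congr (_ *: _); apply: eq_bigr => k _;
      rewrite hornerZ.
  rewrite -controller_stateS.
  under [X in controller_state _ _ X]eq_fun do rewrite derivnS.
  by rewrite dpE; exact: is_derive_poly.
- apply: continuous_matrix => i j.
  under eq_fun do rewrite mxE.
  by move=> t; apply: cvgMr_tmp; exact: continuous_horner.
- exact: controller_state0.
- exact: controller_state0.
Qed.

(** * Markov parameters from a common output *)

(** Two functions continuous at t with different values there differ on a whole ball, which has
    positive measure. *)
Lemma ae_eq_continuous (R : realType) (f g : R -> R) (t : R) :
  {ae (@lebesgue_measure R), forall s, f s = g s} ->
  {for t, continuous f} -> {for t, continuous g} -> f t = g t.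
Proof.
move=> [N [mN N0 fgN]] cf cg; apply/eqP; apply: contraT => fgt.
have : \forall s \near t, f s - g s != 0.
  have cfg : f s - g s @[s --> t] --> f t - g t by exact: cvgB.
  apply: (cvgr_neq0 _ cfg); by rewrite subr_eq0.
move=> /nbhs_ballP[e /= e0 te].
have : (lebesgue_measure (ball t e) <= 0%:E)%E.
  rewrite -[leRHS]N0; apply: le_measure; rewrite ?inE //; first exact: measurable_ball.
  by move=> s /te; rewrite subr_eq0 => /eqP fgs; apply: fgN.
rewrite lebesgue_measure_ball ?(ltW e0) //.
by rewrite lee_fin leNgt mulrn_wgt0.
Qed.

(* Both states are driven by the same input, so differentiating an identity
   between their observations uses only continuity of the input. *)
Lemma trajectory_observation_derive (R : realType) (n m q : nat)
    (S1 S2 : system R n m) (u : R -> 'cV[R]_m) (x p : R -> 'cV[R]_n)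
    (M1 M2 : 'M[R]_(q, n)) (O : set R) :
  open O -> L2_signal u -> state_trajectory S1 u x -> state_trajectory S2 u p ->
  (forall t, O t -> forall j, {for t, continuous (fun s => u s j 0)}) ->
  (forall t, O t -> M1 *m x t = M2 *m p t) ->
  forall t, O t -> M1 *m (sysA S1 *m x t + sysB S1 *m u t) =
                   M2 *m (sysA S2 *m p t + sysB S2 *m u t).
Proof.
move=> oO u2 xS pS cu eqO t Ot; apply/colP => i.
have cf (S : system R n m) (z : R -> 'cV[R]_n) (M : 'M[R]_(q, n)) : state_trajectory S u z ->
    {for t, continuous (fun s => (M *m (sysA S *m z s + sysB S *m u s)) i 0)}.
  move=> [cz _]; apply: cvg_mulmx_entry => k.
  rewrite [X in _ --> X]mxE; under eq_fun do rewrite mxE.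
  apply: cvgD; apply: cvg_mulmx_entry => j; last exact: cu.
  by apply: continuous_entry; exact: cz.
have dx := trajectory_is_derive u2 xS (cf _ _ M1 xS).
have dp := trajectory_is_derive u2 pS (cf _ _ M2 pS).
rewrite -(derive_val (is_derive := dx)) -(derive_val (is_derive := dp)).
apply: near_eq_derive => //.
near=> s; rewrite eqO //; near: s; exact: open_nbhs_nbhs.
Unshelve. all: by end_near. Qed.

(** The outputs are compared on ]0, 1[, where the input is continuous. The limits at 0 from the
    right, with both states at rest and the input tending to [v], isolate the coefficient of the
    input. *)
Definition common_output (R : realType) (n m : nat) (S1 S2 : system R n m)
    (v : 'cV[R]_m) (u : R -> 'cV[R]_m) (x p : R -> 'cV[R]_n) : Prop :=
  [/\ L2_signal u, state_trajectory S1 u x, state_trajectory S2 u p,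
      x 0 = 0 & p 0 = 0] /\
  [/\ forall j, u t j 0 @[t --> 0^'+] --> v j 0,
      forall t : R, `]0, 1[%classic t ->
        forall j, {for t, continuous (fun s => u s j 0)} &
      forall t : R, `]0, 1[%classic t -> output S1 u x t = output S2 u p t].

Lemma common_output_feedthrough (R : realType) (n m q : nat)
    (S1 S2 : system R n m) v u x p (M1 M2 : 'M[R]_(q, n)) (N1 N2 : 'M[R]_(q, m)) :
  common_output S1 S2 v u x p ->
  (forall t : R, `]0, 1[%classic t ->
     M1 *m x t + N1 *m u t = M2 *m p t + N2 *m u t) ->
  N1 *m v = N2 *m v.
Proof.
move=> [[u2 [cx _] [cp _] x0 p0] [uv cu _]] eqO; apply/colP => i.
have lim (z : R -> 'cV[R]_n) (M : 'M[R]_(q, n)) (N : 'M[R]_(q, m)) :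
    continuous z -> z 0 = 0 ->
    (M *m z t + N *m u t) i 0 @[t --> 0^'+] --> (N *m v) i 0.
  move=> cz z0.
  have -> : (N *m v) i 0 = (M *m z 0 + N *m v) i 0 by rewrite z0 mulmx0 add0r.
  apply: cvg_mulmxD_entry => // j; apply: cvg_at_right_filter.
  by apply: cvg_entry; exact: cz.
have lim1 := lim x M1 N1 cx x0; have lim2 := lim p M2 N2 cp p0.
apply: (cvg_unique _ lim1) => //.
apply: cvg_trans lim2; apply: near_eq_cvg; near=> t.
rewrite eqO //= in_itv /=; apply/andP; split; near: t.
  exact: nbhs_right_gt.
exact: nbhs_right_lt.
Unshelve. all: by end_near. Qed.

(** Induction on k: differentiating the agreement of the observations C A^k x gives agreement of C
    A^(k+1) x + (C A^k B) u. The limit at 0 equates the gains of u, and cancelling them yields the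
    next agreement. *)
Lemma common_output_markov (R : realType) (n m : nat) (S1 S2 : system R n m) :
  (forall v, exists u x p, exists2 c : R, c != 0 &
     common_output S1 S2 (c *: v) u x p) ->
  sysD S1 = sysD S2 /\
  (forall k, sysC S1 *m sysA S1 ^+ k *m sysB S1 =
             sysC S2 *m sysA S2 ^+ k *m sysB S2).
Proof.
move=> test.
(* Testing on basis vectors compares the columns; the nonzero scalar c supplied with each test
   cancels. *)
have eq_gain (N1 N2 : 'M[R]_m) :
    (forall v u x p, common_output S1 S2 v u x p -> N1 *m v = N2 *m v) -> N1 = N2.
  move=> eqN; apply/matrixP => i j.
  have [u [x [p [c c0 /eqN]]]] := test (delta_mx j 0).
  rewrite -!scalemxAr => /(scalerI c0) /colP/(_ i).
  by rewrite -!colE !mxE.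
have eqD : sysD S1 = sysD S2.
  apply: eq_gain => v u x p co.
  have [_ [_ _ out]] := co.
  exact: (@common_output_feedthrough _ _ _ _ S1 S2 v u x p (sysC S1) (sysC S2)).
pose state_eq k := forall v u x p, common_output S1 S2 v u x p ->
  forall t : R, `]0, 1[%classic t ->
    sysC S1 *m sysA S1 ^+ k *m x t = sysC S2 *m sysA S2 ^+ k *m p t.
have step k : state_eq k ->
    sysC S1 *m sysA S1 ^+ k *m sysB S1 = sysC S2 *m sysA S2 ^+ k *m sysB S2 /\
    state_eq k.+1.
  move=> eqk.
  have eqS v u x p : common_output S1 S2 v u x p ->
    forall t : R, `]0, 1[%classic t ->
      sysC S1 *m sysA S1 ^+ k.+1 *m x t +
        sysC S1 *m sysA S1 ^+ k *m sysB S1 *m u t =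
      sysC S2 *m sysA S2 ^+ k.+1 *m p t +
        sysC S2 *m sysA S2 ^+ k *m sysB S2 *m u t.
    move=> co t t01; have [[u2 xS pS _ _] [_ cu _]] := co.
    have o01 : open (`]0, 1[%classic : set R) by exact: interval_open.
    have := trajectory_observation_derive o01 u2 xS pS cu (eqk _ _ _ _ co) t01.
    by rewrite !mulmxDr !exprSr -!mulmxE !mulmxA.
  have eqH : sysC S1 *m sysA S1 ^+ k *m sysB S1 = sysC S2 *m sysA S2 ^+ k *m sysB S2.
    apply: eq_gain => v u x p co.
    exact: common_output_feedthrough (co) (eqS _ _ _ _ co).
  by split=> // v u x p co t /(eqS _ _ _ _ co); rewrite eqH => /addIr.
have state_eqT k : state_eq k.
  elim: k => [|k /step[]//] v u x p co t t01; rewrite !expr0 !mulmx1.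
  have [_ [_ _ /(_ t t01)]] := co; rewrite /output eqD; exact: addIr.
by split=> // k; have [] := step k (state_eqT k).
Qed.

(** Before time 0 the motion is free with C p = 0. Repeated differentiation gives C A^k p = 0 there,
    hence p = 0, and continuity carries this to time 0. *)
Lemma trajectory_unobserved_eq0 (R : realType) (n m : nat) (S : system R n m)
    (u : R -> 'cV[R]_m) (p : R -> 'cV[R]_n) :
  (forall v : 'cV[R]_n, (forall k, sysC S *m sysA S ^+ k *m v = 0) -> v = 0) ->
  L2_signal u -> state_trajectory S u p -> (forall t, t < 0 -> u t = 0) ->
  (forall t, t < 0 -> sysC S *m p t = 0) -> p 0 = 0.
Proof.
move=> obs u2 pS u0 Cp0.
have oO : open `]-oo, (0 : R)[%classic by exact: interval_open.
have cu (t : R) : `]-oo, 0[%classic t -> forall j, {for t, continuous (fun s => u s j 0)}.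
  rewrite /= in_itv /= => t0 j; rewrite /prop_for /continuous_at u0 // mxE.
  apply: cvg_near_cst; near=> s; rewrite u0 ?mxE //; near: s; exact: lt_nbhsl.
have CAp k t : t < 0 -> sysC S *m sysA S ^+ k *m p t = 0.
  elim: k t => [|k IHk] t t0; first by rewrite expr0 mulmx1 Cp0.
  (* The zero observation is expressed as a zero matrix acting on the same state, so that the
     two-system differentiation lemma applies to [p] against itself. *)
  have eq0 s : `]-oo, (0 : R)[%classic s ->
      sysC S *m sysA S ^+ k *m p s = (0 : 'M[R]_(m, n)) *m p s.
    by rewrite /= in_itv /= => s0; rewrite mul0mx IHk.
  have /= := trajectory_observation_derive oO u2 pS pS cu eq0.
  move=> /(_ t); rewrite in_itv /= => /(_ t0).
  by rewrite u0 // mulmx0 addr0 mul0mx exprSr -mulmxE !mulmxA.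
have p0 t : t < 0 -> p t = 0 by move=> t0; apply: obs => k; exact: CAp.
apply/colP => i; rewrite [RHS]mxE.
have lim : p t i 0 @[t --> 0^'-] --> p 0 i 0.
  by apply: cvg_at_left_filter; apply: cvg_entry; exact: (proj1 pS).
apply: (cvg_unique _ lim) => //.
apply: cvg_near_cst; near=> t; rewrite p0 ?mxE //; near: t; exact: nbhs_left_lt.
Unshelve. all: by end_near. Qed.

Lemma compact_behavior_common_output (R : realType) (n m : nat)
    (S1 S2 : system R n m) (v : 'cV[R]_m) :
  (forall w : 'cV[R]_n, (forall k, sysC S2 *m sysA S2 ^+ k *m w = 0) -> w = 0) ->
  compact_behavior S1 `<=` compact_behavior S2 ->
  exists u x p, exists2 c : R, c != 0 & common_output S1 S2 (c *: v) u x p.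
Proof.
move=> obs sub12.
have [U [X [c c0 [XU cU X0 X1 U0]]]] := controller_transition S1 v.
have cX : continuous X.
  apply: continuous_matrix => i j t; rewrite (ord1 j).
  by apply: differentiable_continuous; apply/derivable1_diffP.
pose u := cutoff U; pose x := cutoff X.
pose Y t := sysC S1 *m X t + sysD S1 *m U t.
have cY : continuous Y.
  apply: continuous_matrix => i j t.
  by apply: cvg_mulmxD_entry => k; apply: cvg_entry; [exact: cX|exact: cU].
have yE : output S1 u x = cutoff Y.
  by apply/funext => t; rewrite /output /u /x !cutoff_mulmx cutoffD.
have u2 : L2_signal u by exact: cutoff_L2.
have xS : state_trajectory S1 u x by exact: cutoff_trajectory.
(* The state [p] of [S2] comes from the inclusion of behaviors alone; that it is at rest at time 0
   is derived later from observability. *)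
have /sub12[/= _ _ _ _ [p pS yp]] : compact_behavior S1 (u, cutoff Y).
  split=> //=.
  - exact: cutoff_L2.
  - exact: cutoff_compact_support.
  - exact: cutoff_compact_support.
  - by exists x => //; apply: aeW => t; rewrite yE.
have cp := proj1 pS.
have cutoff_out k (f : R -> 'cV[R]_k) t : t < 0 -> cutoff f t = 0.
  by rewrite /cutoff leNgt => ->.
have cutoff_in k (f : R -> 'cV[R]_k) (t : R) : `]0, 1[%classic t ->
    \forall s \near t, cutoff f s = f s.
  move=> t01; near=> s; rewrite /cutoff.
  have : `]0, 1[%classic s.
    by near: s; apply: open_nbhs_nbhs; split=> //; exact: interval_open.
  by rewrite /= in_itv /= => /andP[/ltW -> /ltW ->].
have cutoff_cont k (f : R -> 'cV[R]_k) (t : R) i : continuous f ->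
    (t < 0) \/ `]0, 1[%classic t -> {for t, continuous (fun s => cutoff f s i 0)}.
  move=> cf [t0|t01].
    rewrite /prop_for /continuous_at cutoff_out // mxE.
    apply: cvg_near_cst; near=> s; rewrite cutoff_out ?mxE //.
    by near: s; exact: lt_nbhsl.
  have fE := cutoff_in k f t t01.
  rewrite /prop_for /continuous_at (nbhs_singleton fE).
  have cfi : f s i 0 @[s --> t] --> f t i 0 by apply: cvg_entry; exact: cf.
  apply: cvg_trans cfi; apply: near_eq_cvg.
  by apply: filterS fE => s ->.
(* The output equation of [p] holds almost everywhere. Both sides are continuous off the jump times
   0 and 1, so it holds at every point considered. *)
have output_eq t : (t < 0) \/ `]0, 1[%classic t -> cutoff Y t = output S2 u p t.
  move=> tO; apply/colP => i.
  apply: (@ae_eq_continuous _ (fun s => cutoff Y s i 0) (fun s => output S2 u p s i 0)).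
  - have aeF := ae_filter_ringOfSetsType (@lebesgue_measure R).
    by apply: filterS yp => s ->.
  - exact: cutoff_cont.
  apply: cvg_mulmxD_entry => k; first by apply: cvg_entry; exact: cp.
  exact: cutoff_cont.
exists u, x, p, c => //; split; split=> //.
- by rewrite /x /cutoff lexx ler01.
- apply: (trajectory_unobserved_eq0 obs u2 pS) => t t0; first exact: cutoff_out.
  have := output_eq t (or_introl t0); rewrite cutoff_out // /output /u cutoff_out //.
  by rewrite mulmx0 addr0.
- move=> j; rewrite -U0.
  have : U t j 0 @[t --> 0^'+] --> U 0 j 0.
    by apply: cvg_at_right_filter; apply: cvg_entry; exact: cU.
  apply: cvg_trans; apply: near_eq_cvg; near=> t.
  rewrite /u /cutoff; case: ifPn => // /negP[]; apply/andP; split;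
    by rewrite ltW //; near: t.
- by move=> t t01 j; apply: cutoff_cont => //; right.
- by move=> t t01; rewrite yE; apply: output_eq; right.
Unshelve. all: by end_near. Qed.

(** * Behaviors of similar systems and the equivalence *)

Lemma similar_compact_behavior (R : realType) (n m : nat) (S1 S2 : system R n m)
    (Q : 'M[R]_n) :
  Q *m sysA S1 = sysA S2 *m Q -> Q *m sysB S1 = sysB S2 ->
  sysC S2 *m Q = sysC S1 -> sysD S1 = sysD S2 ->
  compact_behavior S1 `<=` compact_behavior S2.
Proof.
move=> QA QB QC eqD [u y] /= [u2 y2 us ys [x xS yE]]; split=> //.
exists (fun t => Q *m x t); first exact: similar_trajectory xS.
have aeF := ae_filter_ringOfSetsType (@lebesgue_measure R).
by apply: filterS yE => t ->; rewrite /output mulmxA QC eqD.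
Qed.

Lemma expr_oppr_trmx (R : comNzRingType) (n : nat) (A : 'M[R]_n) k :
  (- A^T) ^+ k = (-1) ^+ k *: (A ^+ k)^T.
Proof.
elim: k => [|k IHk]; first by rewrite !expr0 scale1r trmx1.
rewrite exprS IHk -mulmxE mulNmx -scalemxAr -scaleN1r scalerA -exprS.
by rewrite -trmx_mul mulmxE -exprSr.
Qed.

Theorem proposition5 (R : realType) (n m : nat)
    (A : 'M[R]_n) (B : 'M[R]_(n, m)) (C : 'M[R]_(m, n)) (D : 'M[R]_m) :
  minimal (System A B C D) ->
  (io_hamiltonian 1%:M (System A B C D) <->
   compact_behavior (System A B C D) =
     compact_behavior (System (- A^T) (- C^T) B^T D^T)).
Proof.
set S := System A B C D; set Sa := System _ _ _ _ => -[ctrl obs].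
have ctrl1 (w : 'rV[R]_n) : (forall k, w *m A ^+ k *m B = 0) -> w = 0.
  exact: (controllable_annihilator ctrl).
have obs1 (v : 'cV[R]_n) : (forall k, C *m A ^+ k *m v = 0) -> v = 0.
  exact: (observable_annihilator obs).
(* Observability of the adjoint is controllability of [S] transposed: B^T (-A^T)^k v is, up to sign,
   the transpose of v^T A^k B. *)
have obs2 (v : 'cV[R]_n) : (forall k, sysC Sa *m sysA Sa ^+ k *m v = 0) -> v = 0.
  move=> CAv; rewrite -[v]trmxK [v^T]ctrl1 ?trmx0 // => k.
  have := CAv k; rewrite /= expr_oppr_trmx -scalemxAr -scalemxAl => /eqP.
  rewrite scaler_eq0 signr_eq0 /= => /eqP /(congr1 trmx).
  by rewrite trmx0 !trmx_mul !trmxK mulmxA.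
have iso : (sysD S = sysD Sa /\ forall k, sysC S *m sysA S ^+ k *m sysB S =
    sysC Sa *m sysA Sa ^+ k *m sysB Sa) ->
  exists Q, [/\ Q \in unitmx, Q *m sysA S = sysA Sa *m Q,
    Q *m sysB S = sysB Sa & sysC Sa *m Q = sysC S].
  by move=> [_]; exact: state_space_isomorphism.
rewrite io_hamiltonianP; split=> [/transfer_markov markov | eqB].
  have [Q [Qu QA QB QC]] := iso markov.
  apply/seteqP; split.
    exact: (similar_compact_behavior QA QB QC (proj1 markov)).
  apply: (@similar_compact_behavior _ _ _ Sa S (invmx Q)).
  - by apply: (canRL (mulmxK Qu)); rewrite -mulmxA -QA mulKmx.
  - by rewrite -QB mulKmx.
  - by rewrite -QC mulmxK.
  - by rewrite (proj1 markov).
have subB : compact_behavior S `<=` compact_behavior Sa by rewrite eqB.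
have markov := common_output_markov (fun v =>
  compact_behavior_common_output v obs2 subB).
(* Markov parameters are turned back into transfer matrices through the state isomorphism, since
   similar systems share K(s). *)
have [Q [_ QA QB QC]] := iso markov.
exact: (transfer_similar QA QB QC (proj1 markov)).
Qed.
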